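(* For each $k\ge1$ and each functional $\Theta$ satisfying $\mathsf{SFF}(\Theta)$, the combination $\mathbf S_k^2+\Theta$ computes a realiser for $\Pi^1_k\text{-}\mathsf{TR}_0$.
   Context: The metatheory is $\mathsf{ZFC}$ and ''computes'' refers to Kleene's schemes S1–S9. Type $0$ is $\mathbb N$, type $1$ is $\mathbb N\to\mathbb N$, type $2$ is $(\mathbb N\to\mathbb N)\to\mathbb N$. $\mathbf S_k^2$ is the type $2$ functional with values in $\{0,1\}$ that decides $\Sigma^1_k$-formulas in Kleene normal form: $\mathbf S_k^2(f)=0$ iff $(\exists g_1\in\mathbb N^{\mathbb N})(\forall g_2\in\mathbb N^{\mathbb N})\cdots(\mathsf Qg_k\in\mathbb N^{\mathbb N})(\mathsf Q'x\in\mathbb N)\big(f(\langle\overline{g_1}x,\dots,\overline{g_k}x\rangle)=0\big)$, up to the usual placement of ''$=0$'' or ''$\neq 0$'' in the matrix, where $\mathsf Q'$ is the quantifier dual to $\mathsf Q$ and $\overline gx=\langle g(0),\dots,g(x-1)\rangle$; for $k=1$: $\mathbf S_1^2(f)=0\leftrightarrow(\exists g)(\forall n)(f(\overline gn)=0)$. $\mathsf{SFF}(\Theta)$, for $\Theta$ mapping each $G:\mathbb N^{\mathbb N}\to\mathbb N$ to a finite sequence of elements of $2^{\mathbb N}$: for all such $G$ and all $f\in2^{\mathbb N}$ there is $g\in\Theta(G)$ such that $f\in[\overline gG(g)]$, where $[\sigma]$ is the set of binary sequences extending the finite sequence $\sigma$. $\Pi^1_k\text{-}\mathsf{TR}_0$: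 for any $\Pi^1_k$-formula $\theta$ of second-order arithmetic and $X\subseteq\mathbb N$, $\mathsf{WO}(X)\to(\exists Y\subseteq\mathbb N)H_\theta(X,Y)$. Here $\mathsf{WO}(X)$ says that $X$ codes a countable well-ordering $<_X$, and $H_\theta(X,Y)$ says that $X$ is a linear ordering and $Y=\{(m,j):j\in\mathrm{field}(X)\wedge\theta(m,Y^j)\}$, where $Y^j=\{(m,i):i<_Xj\wedge(m,i)\in Y\}$. A realiser for $\Pi^1_k\text{-}\mathsf{TR}_0$ is a functional that takes as input $X\subseteq\mathbb N$, a binary relation $<_X$, and $f:\mathbb N\to\mathbb N$, and outputs $Y\subseteq\mathbb N$ such that $H_\theta(X,Y)$ holds if $\mathsf{WO}(X)$ and $\theta$ is the $\Pi^1_k$-formula in Kleene normal form whose innermost quantifier-free part is given by $f$; i.e. $\theta(n,Z)$ is $(\forall g_1)(\exists g_2)\cdots(\mathsf Qg_k)(\mathsf Q'x)\big(f(\langle\overline{g_1}x,\dots,\overline{g_k}x,\overline Zx,n\rangle)=0\big)$ with $\overline Zx$ the initial segment of length $x$ of the characteristic function of $Z$. *)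

(* Defs.v *)
From mathcomp Require Import all_boot.
From mathcomp Require Import boolp.
From Stdlib Require Arith.Cantor Lists.List.

Set Implicit Arguments.
Unset Strict Implicit.
Unset Printing Implicit Defensive.

Definition pair_code (a b : nat) : nat := Cantor.to_nat (a, b).
Definition unpair (n : nat) : nat * nat := Cantor.of_nat n.

(* A bijection from [seq nat] onto [nat]. *)
Definition seq_code (s : seq nat) : nat :=
  foldr (fun a c => (pair_code a c).+1) 0 s.

(* Codes tuples of a length that is fixed in advance, with <a> = a, so that for
   k = 1 the matrix of a Kleene normal form is applied to [bar g x] itself. *)
Fixpoint tuple_code (s : seq nat) : nat :=
  match s with
  | [::] => 0
  | [:: a] => a
  | a :: s' => pair_code a (tuple_code s')
  end.

Definition bar (g : nat -> nat) (x : nat) : nat := seq_code (mkseq g x).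

(* Subsets of N and elements of 2^N are both of type [nat -> bool]. *)
Definition chi (Z : nat -> bool) : nat -> nat := fun n => nat_of_bool (Z n).

Definition chi2 (R : nat -> nat -> bool) : nat -> nat :=
  fun n => nat_of_bool (R (unpair n).1 (unpair n).2).

Fixpoint ty (n : nat) : Type := if n is n'.+1 then ty n' -> nat else nat.

Definition arg : Type := {n : nat & ty n}.
Definition Arg (n : nat) (x : ty n) : arg := existT ty n x.
Definition num (x : nat) : arg := Arg (n := 0) x.
Definition fct (f : nat -> nat) : arg := Arg (n := 1) f.

(* [kleene e args v] is {e}(args) = v. As an inductive predicate it is the least
   relation closed under the schemes; in S8 the functional [Phi] of type n + 2
   is applied only if {d}(xi, Phi, args) is defined for all [xi] of type n. *)
Inductive kleene : nat -> seq arg -> nat -> Prop :=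
| S1 x args :
    kleene (seq_code [:: 1]) (num x :: args) x.+1
| S2 q args :
    kleene (seq_code [:: 2; q]) args q
| S3 x args :
    kleene (seq_code [:: 3]) (num x :: args) x
| S4 e0 e1 args w v :
    kleene e1 args w ->
    kleene e0 (num w :: args) v ->
    kleene (seq_code [:: 4; e0; e1]) args v
| S5_zero e0 e1 args v :
    kleene e0 args v ->
    kleene (seq_code [:: 5; e0; e1]) (num 0 :: args) v
| S5_succ e0 e1 x args w v :
    kleene (seq_code [:: 5; e0; e1]) (num x :: args) w ->
    kleene e1 (num x :: num w :: args) v ->
    kleene (seq_code [:: 5; e0; e1]) (num x.+1 :: args) v
| S6 d p args v :
    perm_eq p (iota 0 (size args)) ->
    kleene d [seq nth (num 0) args i | i <- p] v ->
    kleene (seq_code [:: 6; d; seq_code p]) args v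
| S7 f x args :
    kleene (seq_code [:: 7]) (fct f :: num x :: args) (f x)
| S8 n d (Phi : ty n.+2) args (F : ty n -> nat) :
    (forall xi : ty n, kleene d (Arg xi :: Arg Phi :: args) (F xi)) ->
    kleene (seq_code [:: 8; n.+2; d]) (Arg Phi :: args) (Phi F)
| S9 m d args v :
    m <= size args ->
    kleene d (take m args) v ->
    kleene (seq_code [:: 9; m]) (num d :: args) v.

Definition quant (ex : bool) (A : Type) (P : A -> Prop) : Prop :=
  if ex then exists a, P a else forall a, P a.

(* k alternating function quantifiers followed by the dual number quantifier;
   [ex] tells whether the outermost quantifier is existential, [gs] lists the
   functions quantified so far and [c] the further components of the tuple. *)
Fixpoint normal_form (ex : bool) (k : nat) (f : nat -> nat)
    (c : nat -> seq nat) (gs : seq (nat -> nat)) : Prop :=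
  if k is k'.+1 then
    quant ex (fun g : nat -> nat => normal_form (~~ ex) k' f c (rcons gs g))
  else
    quant ex (fun x : nat => f (tuple_code ([seq bar g x | g <- gs] ++ c x)) = 0).

Definition Sigma1 (k : nat) (f : nat -> nat) : Prop :=
  normal_form true k f (fun _ => [::]) [::].

Definition Pi1 (k : nat) (f : nat -> nat) (n : nat) (Z : nat -> bool) : Prop :=
  normal_form false k f (fun x => [:: bar (chi Z) x; n]) [::].

(* Decides the Sigma^1_k normal form; the value 0 means "true", whereas
   characteristic functions of sets take the value 1 on members. *)
Definition Sfun (k : nat) : ty 2 :=
  fun f => if `[< Sigma1 k f >] then 0 else 1.

Definition SFF (Theta : ((nat -> nat) -> nat) -> seq (nat -> bool)) : Prop :=
  forall (G : (nat -> nat) -> nat) (f : nat -> bool),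
    exists g : nat -> bool,
      List.In g (Theta G) /\ (forall i, i < G (chi g) -> f i = g i).

(* The pure type 3 functional representing Theta. Its argument H is read as the
   pair of G(g) = (H g)_1 and of the number q = (H 0)_0; the value is the length
   of Theta(G) if q = 0, and the n-th value of the i-th entry of Theta(G) if
   q = <i, n> + 1 (and 0 if there is no such entry). *)
Definition type3_of (Theta : ((nat -> nat) -> nat) -> seq (nat -> bool)) : ty 3 :=
  fun H : (nat -> nat) -> nat =>
    let G := fun g : nat -> nat => (unpair (H g)).2 in
    if (unpair (H (fun _ => 0))).1 is q.+1 then
      chi (nth (fun _ => false) (Theta G) (unpair q).1) (unpair q).2
    else size (Theta G).

(* X codes the reflexive order {(i, j) : i <=_X j}, as usual in second-order
   arithmetic; so the one-point ordering has a non-empty field. *)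
Definition leX (X : nat -> bool) (i j : nat) : bool := X (pair_code i j).
Definition fld (X : nat -> bool) (i : nat) : bool := leX X i i.
Definition ltX (X : nat -> bool) (i j : nat) : bool := leX X i j && ~~ leX X j i.

Definition LO (X : nat -> bool) : Prop :=
  [/\ forall i j, leX X i j -> fld X i /\ fld X j,
      forall i j, leX X i j -> leX X j i -> i = j,
      forall i j l, leX X i j -> leX X j l -> leX X i l
    & forall i j, fld X i -> fld X j -> leX X i j \/ leX X j i].

Definition WF (X : nat -> bool) : Prop :=
  ~ exists h : nat -> nat, forall n, ltX X (h n.+1) (h n).

Definition WO (X : nat -> bool) : Prop := LO X /\ WF X.

Definition below (X Y : nat -> bool) (j : nat) : nat -> bool :=
  fun a => ltX X (unpair a).2 j && Y a.

(* Every number is a [pair_code m j], so this determines all of Y. *)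
Definition Hth (theta : nat -> (nat -> bool) -> Prop) (X Y : nat -> bool) : Prop :=
  LO X /\
  forall m j, Y (pair_code m j) <-> fld X j /\ theta m (below X Y j).

Definition TR_functional : Type :=
  (nat -> bool) -> (nat -> nat -> bool) -> (nat -> nat) -> (nat -> bool).

Definition TR_realiser (k : nat) (Psi : TR_functional) : Prop :=
  forall (X : nat -> bool) (lt : nat -> nat -> bool) (f : nat -> nat),
    (forall i j, lt i j = ltX X i j) -> WO X -> Hth (Pi1 k f) X (Psi X lt f).

Definition computes (oracles : seq arg) (Psi : TR_functional) : Prop :=
  exists e : nat, forall X lt f n,
    kleene e [:: num n, fct (chi X), fct (chi2 lt), fct f & oracles]
           (chi (Psi X lt f) n).

(* Main.v *)
(* For a subset Y of N let (m, j) be a first error of Y if Y decides it wrongly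
   for the recursion along X while row i of Y is correct for all i <_X j.  With
   S_k one decides whether Y has an error and finds the least code p of a first
   error; put G(Y) = p + 1.  The set Y0 that satisfies the recursion lies in
   some [g|G(g)] with g in Theta(G).  If g had errors, then g and Y0 would agree
   at p, and also on all rows on which the verdict at p depends, although only
   Y0 is correct at p; hence g = Y0.  So the solution is the error-free entry of
   Theta(G), and n belongs to it iff some entry is error-free and contains n. *)

Require Import Defs.
From mathcomp Require Import all_boot.
From mathcomp Require Import boolp zify.
From Stdlib Require Arith.Cantor Lists.List.

Set Implicit Arguments.
Unset Strict Implicit.
Unset Printing Implicit Defensive.

(** * Structural rules and search *)

Lemma map_nth_iota_size T (x0 : T) (s : seq T) n :
  size s = n -> [seq nth x0 s i | i <- iota 0 n] = s.
Proof. by move=> <-; apply: mkseq_nth. Qed.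

(* S6 moves the selected arguments to the front, S9 discards the others. *)
Lemma kleene_rename N (p : seq nat) (e : nat) :
  uniq p -> all (fun j => j < N) p ->
  exists e', forall args v, size args = N ->
    kleene e [seq nth (num 0) args j | j <- p] v -> kleene e' args v.
Proof.
move=> up /allP bp.
pose q := p ++ [seq j <- iota 0 N | j \notin p].
exists (seq_code [:: 6; seq_code [:: 4; seq_code [:: 9; size p]; seq_code [:: 2; e]];
                     seq_code q]) => args v sz ke.
apply: S6.
  rewrite sz; apply: uniq_perm; rewrite ?iota_uniq //.
    rewrite cat_uniq up filter_uniq ?iota_uniq // andbT.
    by apply/hasPn => j; rewrite mem_filter => /andP[].
  move=> j; rewrite mem_cat mem_filter mem_iota add0n /=.
  by case: (boolP (j \in p)) => //= /bp ->.
apply: S4; first exact: S2.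
apply: S9; first by rewrite size_map size_cat leq_addr.
by rewrite map_cat take_size_cat ?size_map.
Qed.

Lemma kleene_proj N j : j < N ->
  exists e, forall args x, size args = N -> nth (num 0) args j = num x -> kleene e args x.
Proof.
move=> jN; have [|e he] := @kleene_rename N [:: j] (seq_code [:: 3]) isT.
  by rewrite /= jN.
by exists e => args x sa nj; apply: he => //=; rewrite nj; apply: S3.
Qed.

Section Contexts.
Context {I : Type} {N : nat}.
Implicit Types (c : I -> N.-tuple arg) (F : I -> nat).

(** The index is chosen before [i], so one program serves all inputs uniformly. [I] is an arbitrary
    type of parameters; a bound variable is handled by enlarging [I] and the tuple together, as in
    [ext]. *)
Definition computable c F : Prop := exists e, forall i, kleene e (c i) (F i).

Definition ext n c (p : I * ty n) : N.+1.-tuple arg :=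
  [tuple of Arg p.2 :: c p.1].

Definition oracle n c (x : I -> ty n) : Prop :=
  exists2 j, j < N & forall i, nth (num 0) (c i) j = Arg (x i).

End Contexts.
Arguments ext {I N} n c p.

Definition computable1 I N (c : I -> N.-tuple arg) (Y : I -> nat -> nat) : Prop :=
  computable (ext 0 c) (fun p => Y p.1 p.2).

Section Calculus.
Context {I : Type} {N : nat}.
Implicit Types (c : I -> N.-tuple arg) (F t u : I -> nat).

Lemma comp_ext c F F' : F =1 F' -> computable c F -> computable c F'.
Proof. by move=> eF [e he]; exists e => i; rewrite -eF. Qed.

Lemma comp_reparam J (h : J -> I) c F : computable c F -> computable (c \o h) (F \o h).
Proof. by case=> e he; exists e => i; apply: he. Qed.

Lemma comp_rename M (c' : I -> M.-tuple arg) p c F :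
  uniq p -> all (fun j => j < N) p ->
  (forall i, c' i = [seq nth (num 0) (c i) j | j <- p] :> seq arg) ->
  computable c' F -> computable c F.
Proof.
move=> up bp ec [e he]; have [e' he'] := kleene_rename e up bp.
by exists e' => i; apply: he'; rewrite ?size_tuple // -ec.
Qed.

Lemma comp_let c t (F : I -> nat) :
  computable c t -> computable (fun i => [tuple of num (t i) :: c i]) F -> computable c F.
Proof.
move=> [e1 h1] [e0 h0]; exists (seq_code [:: 4; e0; e1]) => i.
exact: S4 (h1 i) (h0 i).
Qed.

Lemma comp1_app c Y t :
  computable1 c Y -> computable c t -> computable c (fun i => Y i (t i)).
Proof.
move=> [e he] ct; apply: (comp_let ct); exists e => i.
exact: (he (i, t i)).
Qed.

Lemma comp_const c q : computable c (fun=> q).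
Proof. by exists (seq_code [:: 2; q]) => i; apply: S2. Qed.

Lemma comp_num c (x : I -> ty 0) : oracle c x -> computable c x.
Proof.
case=> j jN hj; have [e he] := kleene_proj jN.
by exists e => i; apply: he; rewrite ?size_tuple.
Qed.

Lemma oracle_ext m n c (x : I -> ty n) :
  oracle c x -> oracle (ext m c) (fun p => x p.1).
Proof. by case=> j jN hj; exists j.+1 => // p; apply: hj. Qed.

Lemma oracle_head n c : oracle (ext n c) (fun p : I * ty n => p.2).
Proof. by exists 0. Qed.

End Calculus.

Lemma comp_weak I N n (c : I -> N.-tuple arg) (F : I -> nat) :
  computable c F -> computable (ext n c) (fun p => F p.1).
Proof.
move=> /(comp_reparam (fun p : I * ty n => p.1)).
apply: (@comp_rename _ _ _ _ (iota 1 N)); first exact: iota_uniq.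
  by apply/allP => j; rewrite mem_iota add1n => /andP[].
move=> p /=; rewrite -[LHS](mkseq_nth (num 0)) size_tuple /mkseq.
by rewrite (iotaDl 1 0 N) -map_comp.
Qed.

Lemma comp_head I N (c : I -> N.-tuple arg) : computable (ext 0 c) (fun p => p.2).
Proof. exact: comp_num (oracle_head 0 c). Qed.

Lemma comp1_oracle I N (c : I -> N.-tuple arg) (Y : I -> ty 1) :
  oracle c Y -> computable1 c Y.
Proof.
case=> j jN hj.
apply: (@comp_rename _ _ 2 (fun p => [tuple fct (Y p.1); num p.2]) [:: j.+1; 0]) => //=.
- by rewrite ltnS jN.
- by case=> i x /=; rewrite hj.
- by exists (seq_code [:: 7]) => p; apply: S7.
Qed.

(** S8 wants [Phi] in front and keeps it right below the bound argument. So [Phi] is moved to the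
    front, and the program for [F] is composed with the inverse permutation. As [F] is computed on
    all of [ext n c], the totality condition of S8 is met. *)
Lemma comp_S8 I N n (c : I -> N.-tuple arg) (Phi : I -> ty n.+2) F :
  oracle c Phi -> computable (ext n c) F ->
  computable c (fun i => Phi i (fun xi => F (i, xi))).
Proof.
case=> j jN hj cF.
pose r := [seq l <- iota 0 N | l != j]; pose p := j :: r.
have up : uniq p by rewrite /= mem_filter eqxx /= filter_uniq ?iota_uniq.
have mp l : (l \in p) = (l < N).
  by rewrite inE mem_filter mem_iota add0n /=; case: eqP => // ->.
have sp : size p = N.
  rewrite -(size_iota 0 N); apply: perm_size; apply: uniq_perm => //.
    exact: iota_uniq.
  by move=> l; rewrite mp mem_iota.
(* The inverse of [p], shifted by one because position 0 holds the bound argument. *)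
pose q := 0 :: [seq (index l p).+1 | l <- iota 0 N].
have [d hd] : computable (fun x : I * ty n => [tuple of Arg x.2 :: 
    [tuple of [seq nth (num 0) (c x.1) l | l <- in_tuple p]]]) F.
  apply: (@comp_rename _ _ _ (ext n c) q) cF.
  - rewrite /=; apply/andP; split; first by apply/mapP => -[].
    rewrite map_inj_in_uniq ?iota_uniq // => a b; rewrite !mem_iota /= -!mp => ha hb.
    by case=> /(congr1 (nth 0 p)); rewrite !nth_index.
  - rewrite /= all_map; apply/allP => l; rewrite mem_iota /= -mp => hl.
    by move: hl; rewrite -index_mem.
  - move=> x; have hx l : l \in p ->
        nth (num 0) [seq nth (num 0) (c x.1) m | m <- p] (index l p)
        = nth (num 0) (c x.1) l.
      by move=> hl; rewrite (nth_map 0) ?index_mem // nth_index.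
    rewrite /=; congr cons; rewrite -[LHS](mkseq_nth (num 0)) size_tuple /mkseq.
    rewrite -map_comp; apply/eq_in_map => l; rewrite mem_iota /= -mp => hl.
    exact: esym (hx l hl).
exists (seq_code [:: 6; seq_code [:: 8; n.+2; d]; seq_code p]) => i.
apply: S6.
  rewrite size_tuple; apply: uniq_perm => //; first exact: iota_uniq.
  by move=> l; rewrite mp mem_iota.
rewrite /= hj; apply: S8 => xi.
by have := hd (i, xi); rewrite /= hj.
Qed.

Lemma comp_rec I N (c : I -> N.-tuple arg) (t z : I -> nat) (s : I -> nat -> nat -> nat) :
  computable c t -> computable c z ->
  computable (ext 0 (ext 0 c)) (fun p => s p.1.1 p.2 p.1.2) ->
  computable c (fun i => nat_rect (fun=> nat) (z i) (s i) (t i)).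
Proof.
move=> ct [e0 h0] [e1 h1]; apply: (comp_let ct).
exists (seq_code [:: 5; e0; e1]) => i /=.
elim: (t i) => [|x IH]; first exact: S5_zero.
exact: S5_succ IH (h1 (i, _, x)).
Qed.

(* There is no minimisation scheme: the search is a program that receives its
   own index as an argument and calls it through S9.  S5 evaluates the base case
   even at successors, so the base case returns the candidate and the recursive
   call sits in the successor branch. *)
Lemma comp_mu I N (c : I -> N.-tuple arg) (R : I -> nat -> bool)
    (exR : forall i, exists n, R i n) :
  computable1 c (fun i n => ~~ R i n) -> computable c (fun i => ex_minn (exR i)).
Proof.
case=> eR hR.
(* The recursive call: [n.+1] and two copies of [d] are pushed, and the four numbers [0, n, d, n]
   below them are dropped. S9 consumes one copy as the index to run; the other is passed on as an
   argument. *)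
have [e1 h1] : exists e, forall d n (a : seq arg) v, size a = N ->
    kleene d [:: num d, num n.+1 & a] v ->
    kleene e [:: num 0, num n, num d, num n & a] v.
  have [e he] := @kleene_rename (7 + N) ([:: 0; 1; 2] ++ iota 7 N)
                   (seq_code [:: 9; N.+2])
    ltac:(by rewrite cat_uniq iota_uniq andbT; apply/hasPn => j;
           rewrite mem_iota !inE; lia)
    ltac:(by rewrite all_cat /=; apply/allP => j; rewrite mem_iota; lia).
  have [s hs] := @kleene_proj N.+4 3 isT.
  have [d1 hd1] := @kleene_proj N.+4.+1 3 isT.
  have [d2 hd2] := @kleene_proj N.+4.+2 0 isT.
  exists (seq_code [:: 4; seq_code [:: 4; seq_code [:: 4; e; d2]; d1];
                      seq_code [:: 4; seq_code [:: 1]; s]]) => d n a v sa hv.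
  apply: S4.
    apply: S4; last exact: S1.
    by apply: hs; rewrite //= sa.
  apply: S4; first by apply: hd1; rewrite //= sa.
  apply: S4; first by apply: hd2; rewrite //= sa.
  apply: he; rewrite /= ?sa //.
  rewrite (iotaDl 7 0 N) -map_comp /=.
  rewrite map_nth_iota_size //.
  apply: S9; first by rewrite /= sa.
  by rewrite /= -sa take_size.
have [r hr] := @kleene_rename N.+2 (iota 1 N.+1) eR (iota_uniq _ _)
  ltac:(by apply/allP => j; rewrite mem_iota; lia).
have [e0 he0] := @kleene_proj N.+2 1 isT.
(* [E] expects its own index, the current candidate and the context; it tests the candidate and
   branches by S5 on the outcome. *)
pose E := seq_code [:: 4; seq_code [:: 5; e0; e1]; r].
exists (seq_code [:: 4; seq_code [:: 4; E; seq_code [:: 2; E]]; seq_code [:: 2; 0]]) => i.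
apply: S4; first exact: S2.
apply: S4; first exact: S2.
case: ex_minnP => n Rn minn.
(* Induction on the distance [m] from the candidate [l] to the least solution [n]. *)
suff H m l : l + m = n -> kleene E [:: num E, num l & c i] n by exact: (H n).
elim: m l => [|m IH] l lmn.
  apply: S4.
    apply: hr; first by rewrite /= size_tuple.
    rewrite (iotaDl 1 0) -map_comp /= (iotaDl 1 0) -map_comp /=.
    rewrite map_nth_iota_size ?size_tuple //.
    exact: (hR (i, l)).
  rewrite /= -[l in R i l](addn0 l) lmn Rn /=; apply: S5_zero.
  by apply: he0; rewrite //= ?size_tuple // -lmn addn0.
apply: S4.
  apply: hr; first by rewrite /= size_tuple.
  rewrite (iotaDl 1 0) -map_comp /= (iotaDl 1 0) -map_comp /=.
  rewrite map_nth_iota_size ?size_tuple //.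
  exact: (hR (i, l)).
have -> : ~~ R i l by apply/negP => /minn; lia.
apply: S5_succ.
  by apply: S5_zero; apply: he0; rewrite //= size_tuple.
by apply: h1; rewrite ?size_tuple //; apply: IH; lia.
Qed.

Lemma comp_weak1 I N n (c : I -> N.-tuple arg) (Y : I -> nat -> nat) :
  computable1 c Y -> computable1 (ext n c) (fun p => Y p.1).
Proof.
move=> /(comp_reparam (fun q : I * ty n * nat => (q.1.1, q.2))).
(* Position 0 is the number argument; position 1, the argument just pushed, is dropped. *)
apply: (@comp_rename _ _ _ _ (0 :: iota 2 N)).
- by rewrite /= iota_uniq mem_iota.
- by apply/allP => j; rewrite inE mem_iota; lia.
move=> q /=; congr cons; rewrite (iotaDl 2 0 N) -map_comp /=.
by rewrite -[LHS](map_nth_iota_size (num 0) (size_tuple _)).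
Qed.

(** * Arithmetic and sequence codes *)

Notation computableb c B := (computable c (fun i => nat_of_bool (B i))).

Lemma comp_succ I N (c : I -> N.-tuple arg) t :
  computable c t -> computable c (fun i => (t i).+1).
Proof. by move=> ct; apply: (comp_let ct); exists (seq_code [:: 1]) => i; apply: S1. Qed.

Lemma comp_pred I N (c : I -> N.-tuple arg) t :
  computable c t -> computable c (fun i => (t i).-1).
Proof.
move=> ct.
apply: (comp_ext _ (comp_rec (z := fun=> 0) (s := fun _ n _ => n) ct _ _)).
- by move=> i; case: (t i).
- exact: comp_const.
- exact: comp_head.
Qed.

Lemma comp_add I N (c : I -> N.-tuple arg) t u :
  computable c t -> computable c u -> computable c (fun i => t i + u i).
Proof.
move=> ct cu.
apply: (comp_ext _ (comp_rec (s := fun _ _ w => w.+1) ct cu _)).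
- by move=> i; elim: (t i) => //= n ->.
- exact: comp_succ (comp_weak 0 (comp_head _)).
Qed.

Lemma comp_subn I N (c : I -> N.-tuple arg) t u :
  computable c t -> computable c u -> computable c (fun i => t i - u i).
Proof.
move=> ct cu.
apply: (comp_ext _ (comp_rec (s := fun _ _ w => w.-1) cu ct _)).
- by move=> i; elim: (u i) => [|n] /=; [rewrite subn0|move=> ->; rewrite subnS].
- exact: comp_pred (comp_weak 0 (comp_head _)).
Qed.

(** S5 evaluates its base case first, so [u] is computed even when [t] is selected; this is harmless
    because both are total. *)
Lemma comp_if I N (c : I -> N.-tuple arg) (B : I -> bool) t u :
  computableb c B -> computable c t -> computable c u ->
  computable c (fun i => if B i then t i else u i).
Proof.
move=> cB ct cu.
apply: (comp_ext _ (comp_rec (s := fun i _ _ => t i) cB cu _)).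
- by move=> i; case: (B i).
- exact: (comp_weak 0 (comp_weak 0 ct)).
Qed.

Lemma dec_eq0 I N (c : I -> N.-tuple arg) t :
  computable c t -> computableb c (fun i => t i == 0).
Proof.
move=> ct.
apply: (comp_ext _ (comp_rec (z := fun=> 1) (s := fun _ _ _ => 0) ct _ _)).
- by move=> i; case: (t i).
- exact: comp_const.
- exact: comp_const.
Qed.

Lemma dec_neg I N (c : I -> N.-tuple arg) (B : I -> bool) :
  computableb c B -> computableb c (fun i => ~~ B i).
Proof. by move/dec_eq0; apply: comp_ext => i; case: (B i). Qed.

Lemma dec_and I N (c : I -> N.-tuple arg) (B B' : I -> bool) :
  computableb c B -> computableb c B' -> computableb c (fun i => B i && B' i).
Proof.
move=> cB cB'; apply: (comp_ext _ (comp_if cB cB' (comp_const _ 0))) => i.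
by case: (B i).
Qed.

Lemma dec_or I N (c : I -> N.-tuple arg) (B B' : I -> bool) :
  computableb c B -> computableb c B' -> computableb c (fun i => B i || B' i).
Proof.
move=> cB cB'; apply: (comp_ext _ (comp_if cB (comp_const _ 1) cB')) => i.
by case: (B i).
Qed.

Lemma dec_xor I N (c : I -> N.-tuple arg) (B B' : I -> bool) :
  computableb c B -> computableb c B' -> computableb c (fun i => B i != B' i).
Proof.
move=> cB cB'; apply: (comp_ext _ (comp_if cB (dec_neg cB') cB')) => i.
by case: (B i); case: (B' i).
Qed.

(** Triangular numbers, written with the recursor that [Cantor.to_nat] unfolds to, so that
    [pair_codeE] holds by conversion. *)
Definition tri (n : nat) : nat := nat_rect (fun=> nat) 0 (fun m w => m.+1 + w) n.

Lemma pair_codeE a b : pair_code a b = b + tri (b + a).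
Proof. by []. Qed.

Lemma tri_mono : {homo tri : m n / m <= n}.
Proof.
by apply: homo_leq => // [m n p|m]; [apply: leq_trans | rewrite /= leq_addl].
Qed.

Lemma comp_tri I N (c : I -> N.-tuple arg) t :
  computable c t -> computable c (fun i => tri (t i)).
Proof.
move=> ct.
apply: (comp_rec (z := fun=> 0) (s := fun _ m w => m.+1 + w) ct (comp_const _ _)).
exact: comp_add (comp_succ (comp_head _)) (comp_weak 0 (comp_head _)).
Qed.

Lemma comp_pair I N (c : I -> N.-tuple arg) t u :
  computable c t -> computable c u -> computable c (fun i => pair_code (t i) (u i)).
Proof.
by move=> ct cu; apply: comp_add => //; apply: comp_tri; apply: comp_add.
Qed.

Lemma pair_codeK a b : unpair (pair_code a b) = (a, b).
Proof. exact: Cantor.cancel_of_to. Qed.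

Lemma unpairK n : pair_code (unpair n).1 (unpair n).2 = n.
Proof. by rewrite /pair_code -surjective_pairing; apply: Cantor.cancel_to_of. Qed.

Lemma unpair_leq n : (unpair n).1 <= n /\ (unpair n).2 <= n.
Proof.
have := Cantor.to_nat_non_decreasing (unpair n).1 (unpair n).2.
rewrite -[Cantor.to_nat _]/(pair_code _ _) unpairK; lia.
Qed.

(** The code of (x, y) is y plus the triangular number of x + y, so x + y is the least [s] for which
    [tri s.+1] exceeds the code. The search finds this diagonal, and two subtractions then give y
    and x. *)
Lemma comp_unpair I N (c : I -> N.-tuple arg) t : computable c t ->
  computable c (fun i => (unpair (t i)).1) /\ computable c (fun i => (unpair (t i)).2).
Proof.
move=> ct.
pose R i s := t i < tri s.+1.
have exR i : exists s, R i s by exists (t i); rewrite /R /= ltnS leq_addr.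
have minE i : ex_minn (exR i) = (unpair (t i)).2 + (unpair (t i)).1.
  have := unpairK (t i); rewrite pair_codeE /R.
  set x := (unpair _).1; set y := (unpair _).2 => tE.
  case: ex_minnP => s; rewrite -tE => Rs minn; apply/eqP; rewrite eqn_leq.
  rewrite minn /=; last by rewrite addSn ltnS -addnA (addnC x) addnA leq_addr.
  rewrite leqNgt; apply/negP => lt; have := tri_mono lt; move: Rs; lia.
have cs : computable c (fun i => ex_minn (exR i)).
  apply: comp_mu; apply: (comp_ext _ (dec_neg (dec_eq0 (comp_subn
    (comp_succ (comp_weak 0 ct)) (comp_tri (comp_succ (comp_head c))))))) => p.
  by rewrite /R /leq.
have c2 : computable c (fun i => (unpair (t i)).2).
  apply: (comp_ext _ (comp_subn ct (comp_tri cs))) => i.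
  by rewrite minE -{1}(unpairK (t i)) pair_codeE addnK.
split=> //; apply: (comp_ext _ (comp_subn cs c2)) => i.
by rewrite minE addKn.
Qed.

Lemma comp_unpair1 I N (c : I -> N.-tuple arg) t : computable c t ->
  computable c (fun i => (unpair (t i)).1).
Proof. by case/comp_unpair. Qed.

Lemma comp_unpair2 I N (c : I -> N.-tuple arg) t : computable c t ->
  computable c (fun i => (unpair (t i)).2).
Proof. by case/comp_unpair. Qed.

Definition seq_tail (a : nat) : nat := (unpair a.-1).2.

(** A component of a pair is at most its code, so each tail lowers a positive code and [a] steps
    reach 0, the code of the empty sequence. *)
Lemma iter_tail_exists a : exists n, iter n seq_tail a == 0.
Proof.
exists a; rewrite -leqn0 -[leqRHS](subnn a).
elim: {1 4}a => [|n IH]; first by rewrite subn0.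
by rewrite iterS; have [_] := unpair_leq (iter n seq_tail a).-1; rewrite -/(seq_tail _); lia.
Qed.

Definition seq_len (a : nat) : nat := ex_minn (iter_tail_exists a).

Lemma seq_len_bar g x : seq_len (bar g x) = x.
Proof.
have it : forall (s : seq nat) n, iter n seq_tail (seq_code s) = seq_code (drop n s).
  elim=> [|a s IH] [|n] //; last first.
    by rewrite iterSr /seq_tail /= pair_codeK -/seq_tail IH.
  by elim: n => // n IH; rewrite iterS IH.
rewrite /seq_len; case: ex_minnP => n; rewrite it => hn minn; apply/eqP.
rewrite eqn_leq minn; last by rewrite it drop_oversize // size_mkseq.
case: leqP => // nx; move: hn.
by rewrite (drop_nth 0) ?size_mkseq.
Qed.

Lemma bar_head g x : 0 < x -> (unpair (bar g x).-1).1 = g 0.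
Proof. by case: x => // x _; rewrite /bar /= pair_codeK. Qed.

Lemma bar_eq0 g x : (bar g x == 0) = (x == 0).
Proof. by case: x. Qed.

Lemma comp_len I N (c : I -> N.-tuple arg) t : computable c t ->
  computable c (fun i => seq_len (t i)).
Proof.
move=> ct; apply: comp_mu; apply: dec_neg; apply: dec_eq0.
apply: (comp_ext _ (comp_rec (s := fun _ _ w => seq_tail w) (comp_head c) (comp_weak 0 ct) _)).
  by case=> i n /=; elim: n => //= n ->.
exact: comp_unpair2 (comp_pred (comp_weak 0 (comp_head _))).
Qed.

Lemma comp_bar I N (c : I -> N.-tuple arg) Y t : computable1 c Y -> computable c t ->
  computable c (fun i => bar (Y i) (t i)).
Proof.
move=> cY ct.
(* A sequence code is built from the last entry backwards, so step [n] prepends the value at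
   [t i - n.+1]. *)
apply: (comp_ext _ (comp_rec (z := fun=> 0)
  (s := fun i n w => (pair_code (Y i (t i - n.+1)) w).+1) ct (comp_const _ 0) _)).
  move=> i; rewrite /bar.
  suff H n : n <= t i -> nat_rect (fun=> nat) 0
      (fun n w => (pair_code (Y i (t i - n.+1)) w).+1) n
      = seq_code [seq Y i j | j <- iota (t i - n) n].
    by rewrite H // subnn.
  elim: n => [|n IH] // hn /=; rewrite IH ?(ltnW hn) //.
  by rewrite -subSn // subSS.
have cY' := comp_weak1 0 (comp_weak1 0 cY).
have ct' := comp_weak 0 (comp_weak 0 ct).
apply: comp_succ; apply: comp_pair; last exact: (comp_weak 0 (comp_head _)).
apply: (comp1_app cY'); apply: (comp_subn ct'); apply: comp_succ; exact: comp_head.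
Qed.

(** * Quantifiers decided by S_k *)

(** Here [k] is one less than the number of components: [tuple_code] leaves the last component
    unpaired, so a tuple of length one is its own head. *)
Definition tuple_head (k : nat) (c : nat) : nat := if k is 0 then c else (unpair c).1.

Lemma tuple_headE a s : tuple_head (size s) (tuple_code (a :: s)) = a.
Proof. by case: s => // b s; rewrite /= pair_codeK. Qed.

Fixpoint tuple_append (k : nat) (c t : nat) : nat :=
  if k is k'.+1 then pair_code (unpair c).1 (tuple_append k' (unpair c).2 t)
  else pair_code c t.

Lemma tuple_appendE a s z m :
  tuple_append (size s) (tuple_code (a :: s)) (pair_code z m)
  = tuple_code ((a :: s) ++ [:: z; m]).
Proof. by elim: s a => //= b s IH a; rewrite pair_codeK /= IH. Qed.

Lemma comp_tuple_head I N (c : I -> N.-tuple arg) k t :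
  computable c t -> computable c (fun i => tuple_head k (t i)).
Proof. by case: k => // k; apply: comp_unpair1. Qed.

Lemma comp_tuple_append I N (c : I -> N.-tuple arg) k t u :
  computable c t -> computable c u ->
  computable c (fun i => tuple_append k (t i) (u i)).
Proof.
elim: k t => [|k IH] t ct cu /=; first exact: comp_pair.
by apply: comp_pair; [apply: comp_unpair1 | apply: IH => //; apply: comp_unpair2].
Qed.

Lemma quant_neg ex A (P Q : A -> Prop) :
  (forall a, ~ P a <-> Q a) -> ~ quant ex P <-> quant (~~ ex) Q.
Proof.
move=> PQ; case: ex => /=; split.
- by move=> nP a; apply/PQ => Pa; apply: nP; exists a.
- by move=> hQ [a Pa]; case: (PQ a) => _ /(_ (hQ a)).
- by move=> /existsNP[a nPa]; exists a; apply/PQ.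
- by case=> a /PQ nPa hP; apply: nPa.
Qed.

Lemma quant_ext ex A (P Q : A -> Prop) :
  (forall a, P a <-> Q a) -> quant ex P <-> quant ex Q.
Proof.
move=> PQ; case: ex => /=.
  by split=> -[a] /PQ Pa; exists a.
by split=> h a; apply/PQ.
Qed.

Lemma quant_const ex A (a0 : A) (P : Prop) : quant ex (fun _ : A => P) <-> P.
Proof. case: ex; first by split=> [[] //|p]; exists a0.
by split=> [h|p a]; [exact: (h a0) | exact: p]. Qed.

(** Negation dualises the whole prefix, the number quantifier included. Only the matrices must be
    complementary, and only on full lists of functions; this lets the extra components [c] be
    absorbed into the matrix [f']. *)
Lemma normal_form_neg ex k f f' c c' gs :
  (forall (hs : seq (nat -> nat)) x, size hs = size gs + k ->
     f (tuple_code ([seq bar g x | g <- hs] ++ c x)) <> 0 <->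
     f' (tuple_code ([seq bar g x | g <- hs] ++ c' x)) = 0) ->
  ~ normal_form ex k f c gs <-> normal_form (~~ ex) k f' c' gs.
Proof.
elim: k ex gs => [|k IH] ex gs ff' /=; apply: quant_neg => a.
  by apply: ff'; rewrite addn0.
by apply: IH => hs x; rewrite size_rcons addSnnS; apply: ff'.
Qed.

(* The length x of the initial segments is only available through the first
   component of the tuple, which is where k >= 1 is used; from here on k stands
   for the number of function quantifiers minus one. *)
Definition co_matrix (k : nat) (f : nat -> nat) (Z : nat -> nat) (m c : nat) : nat :=
  f (tuple_append k c (pair_code (bar Z (seq_len (tuple_head k c))) m)) == 0.

(** The negated formula is Sigma with the complementary matrix. As [Sfun] returns 0 for truth, its
    value there is already the characteristic value of the Pi formula. *)
Lemma Pi1_Sfun k f m Z :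
  Sfun k.+1 (co_matrix k f (chi Z) m) = `[< Pi1 k.+1 f m Z >].
Proof.
have [H1 H2] : ~ Pi1 k.+1 f m Z <-> Sigma1 k.+1 (co_matrix k f (chi Z) m).
  apply: normal_form_neg => -[//|h hs] x [] shs; rewrite cats0 /co_matrix -shs.
  rewrite -[size hs](size_map (fun g => bar g x)) tuple_headE seq_len_bar tuple_appendE.
  by case: (f _).
rewrite /Sfun; case: asboolP => hS; case: asboolP => hP //.
- by case: (H2 hS).
- by case: hS; apply: H1.
Qed.

(* Reads n as g_1(0).  At length 0 that value is unknown, so the matrix takes the
   neutral value of the innermost number quantifier: 1 (false) for an existential
   one, 0 (true) for a universal one. *)
Definition ex_matrix (k : nat) (R : nat -> bool) (c : nat) : nat :=
  let a := tuple_head k c in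
  if a == 0 then odd k else ~~ R (unpair a.-1).1.

(** The function quantifiers after [g] are vacuous. Since quantifiers alternate, [ex (+) odd k'] is
    invariant along the prefix; at [k' = 0] it says that the number quantifier is existential
    exactly when [k] is odd. *)
Lemma normal_form_ex_matrix ex k' k R g gs :
  k = size gs + k' -> odd k = ex (+) odd k' ->
  normal_form ex k' (ex_matrix k R) (fun=> [::]) (g :: gs) <-> R (g 0).
Proof.
elim: k' ex gs => [|k' IH] ex gs.
  rewrite addn0 addbF => sgs ok /=.
  have mE x : ex_matrix k R (tuple_code ((bar g x :: [seq bar h x | h <- gs]) ++ [::])) =
      if x == 0 then ex : nat else ~~ R (g 0).
    rewrite cats0 /ex_matrix sgs -[size gs](size_map (fun h => bar h x)) tuple_headE.
    by rewrite size_map -sgs ok bar_eq0; case: posnP => // x0; rewrite bar_head.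
  case: ex ok mE => _ /= mE; split.
  - by case=> x; rewrite mE; case: (x == 0) => //; case: (R _).
  (* Length 1 is the first at which [g 0] can be read. *)
  - by move=> Rg; exists 1; rewrite mE /= Rg.
  - by move=> /(_ 1); rewrite mE /=; case: (R _).
  - by move=> Rg x; rewrite mE Rg; case: eqP.
move=> sgs ok; rewrite /= -[X in _ <-> X](@quant_const ex _ (fun=> 0)).
apply: quant_ext => h; apply: IH; first by rewrite size_rcons addSnnS.
by rewrite ok /=; clear ok; case: ex; case: (odd k').
Qed.

(** The leading function quantifier simulates a number quantifier through [g 0], with constant
    functions as witnesses. *)
Lemma ex_Sfun k (R : nat -> bool) :
  Sfun k.+1 (ex_matrix k R) = ~~ `[< exists n, R n >].
Proof.
have H g : normal_form false k (ex_matrix k R) (fun=> [::]) [:: g] <-> R (g 0).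
  by apply: normal_form_ex_matrix; rewrite ?add0n.
rewrite /Sfun; case: asboolP => hS; case: asboolP => hR //.
- by case: hR; case: hS => g /H; exists (g 0).
- by case: hS; case: hR => n Rn; exists (fun=> n); apply/H.
Qed.

Lemma dec_ex k I N (c : I -> N.-tuple arg) (R : I -> nat -> bool) :
  oracle c (fun=> Sfun k.+1 : ty 2) ->
  computableb (ext 0 c) (fun p => R p.1 p.2) ->
  computableb c (fun i => `[< exists n, R i n >]).
Proof.
move=> cS cR.
have cRS : computableb c (fun i => ~~ `[< exists n, R i n >]).
  apply: (comp_ext _ (comp_S8 (n := 0) (F := fun p => ex_matrix k (R p.1) p.2) cS _)) => [i|].
    exact: ex_Sfun.
  have ca := comp_tuple_head k (comp_head c).
  have cR1 : computable1 c (fun i n => R i n) by [].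
  have cRw := comp_weak1 0 cR1.
  have ch := comp1_app cRw (comp_unpair1 (comp_pred ca)).
  apply: (comp_ext _ (comp_if (dec_eq0 ca) (comp_const _ (odd k)) (dec_neg ch))) => p.
  by rewrite /ex_matrix; case: eqP.
by apply: (comp_ext _ (dec_neg cRS)) => i; rewrite negbK.
Qed.

Lemma dec_Pi1 k I N (c : I -> N.-tuple arg) (f : I -> nat -> nat) (m : I -> nat)
    (Z : I -> nat -> bool) :
  oracle c (fun=> Sfun k.+1 : ty 2) -> computable1 c f -> computable c m ->
  computableb (ext 0 c) (fun p => Z p.1 p.2) ->
  computableb c (fun i => `[< Pi1 k.+1 (f i) (m i) (Z i) >]).
Proof.
move=> cS cf cm cZ.
apply: (comp_ext _ (comp_S8 (n := 0) 
  (F := fun p => co_matrix k (f p.1) (chi (Z p.1)) (m p.1) p.2) cS _)) => [i|].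
  by rewrite -Pi1_Sfun.
have cZ1 : computable1 c (fun i => chi (Z i)) by [].
rewrite /co_matrix; apply: dec_eq0; apply: (comp1_app (comp_weak1 0 cf)).
apply: (comp_tuple_append _ (comp_head c)); apply: comp_pair (comp_weak 0 cm).
apply: (comp_bar (comp_weak1 0 cZ1)); apply: comp_len.
exact: comp_tuple_head (comp_head c).
Qed.

(** * First errors and the recursion along X *)

Section Recursion.
Variables (theta : nat -> (nat -> bool) -> Prop) (X : nat -> bool).
Implicit Types (Y : nat -> bool) (p j : nat).

Definition wrong Y p : bool :=
  Y p != (fld X (unpair p).2 && `[< theta (unpair p).1 (below X Y (unpair p).2) >]).

Definition first_wrong Y p : bool :=
  wrong Y p && ~~ `[< exists q, ltX X (unpair q).2 (unpair p).2 && wrong Y q >].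

Definition faulty Y : bool := `[< exists p, first_wrong Y p >].

(** The second disjunct makes the search total: on a set without errors every [p] qualifies, so
    [modulus] is defined everywhere. *)
Lemma first_wrong_or_correct Y : exists p, first_wrong Y p || ~~ faulty Y.
Proof.
rewrite /faulty; case: asboolP => [[p hp]|_]; last by exists 0; rewrite orbT.
by exists p; rewrite hp.
Qed.

Definition modulus Y : nat := (ex_minn (first_wrong_or_correct Y)).+1.

Hypothesis woX : WO X.

Lemma ltX_trans i j l : ltX X i j -> ltX X j l -> ltX X i l.
Proof.
case: woX => -[_ _ tr _] _; rewrite /ltX => /andP[ij nji] /andP[jl nlj].
rewrite (tr i j l) //=; apply: contra nji => li; exact: tr jl li.
Qed.

(** Below a point that is not accessible lies another such point; choice iterates this into a
    descending sequence, which [WF] forbids. *)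
Lemma ltX_wf : well_founded (fun i j => ltX X i j).
Proof.
case: woX => _ wf j; apply: contrapT => nacc; apply: wf.
pose T := {i : nat | ~ Acc (fun i j => ltX X i j) i}.
have step (a : T) : exists b : T, ltX X (sval b) (sval a).
  case: a => a na /=; apply: contrapT => nb; apply: na; constructor => b ba.
  by apply: contrapT => nab; apply: nb; exists (exist _ b nab).
have [s hs] := choice step.
by exists (fun n => sval (iter n s (exist _ j nacc))) => n; apply: hs.
Qed.

Lemma below_eq Y Y' j : (forall q, ltX X (unpair q).2 j -> Y q = Y' q) ->
  below X Y j = below X Y' j.
Proof.
move=> h; apply/funext => a; rewrite /below; case lt: (ltX _ _ _) => //=.
exact: h.
Qed.

(** Induction along [ltX]: the correct verdict at a code depends only on the rows below its own,
    where both sets agree by induction. *)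
Lemma correct_below_unique Y Y' j :
  (forall q, ltX X (unpair q).2 j -> ~~ wrong Y q) ->
  (forall q, ltX X (unpair q).2 j -> ~~ wrong Y' q) ->
  forall q, ltX X (unpair q).2 j -> Y q = Y' q.
Proof.
move=> cY cY' q; move: {2}(unpair q).2 (erefl (unpair q).2) => i.
elim/(well_founded_ind ltX_wf): i q => i IH q qi qj.
have := cY q qj; have := cY' q qj; rewrite /wrong !negbK => /eqP -> /eqP ->.
rewrite (@below_eq Y' Y) // qi => r ri; apply/esym/(IH _ ri) => //.
by apply: ltX_trans ri _; rewrite -qi.
Qed.

(** By well-founded induction, any error would yield an error in a minimal row, and that is a first
    error. *)
Lemma not_faulty Y : ~~ faulty Y <-> forall p, ~~ wrong Y p.
Proof.
split=> [|h]; last first.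
  by apply/asboolP => -[p /andP[wp _]]; have := h p; rewrite wp.
move=> /asboolP nf p; move: {2}(unpair p).2 (erefl (unpair p).2) => i.
elim/(well_founded_ind ltX_wf): i p => i IH p pi; apply/negP => wp.
apply: nf; exists p; rewrite /first_wrong wp /=; apply/asboolP => -[q /andP[qp wq]].
by have := IH (unpair q).2; rewrite -pi => /(_ qp q erefl); rewrite wq.
Qed.

Lemma correct_unique Y Y' : ~~ faulty Y -> ~~ faulty Y' -> Y = Y'.
Proof.
move=> /not_faulty cY /not_faulty cY'; apply/funext => p.
have := cY p; have := cY' p; rewrite /wrong !negbK => /eqP -> /eqP ->.
rewrite (@below_eq Y' Y) // => q qp.
by apply: (@correct_below_unique Y' Y (unpair p).2).
Qed.

Lemma correct_Hth Y : ~~ faulty Y -> Hth theta X Y.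
Proof.
move=> /not_faulty cY; split=> [|m j]; first by case: woX.
have := cY (pair_code m j); rewrite /wrong negbK pair_codeK => /eqP ->.
by split=> [/andP[fj /asboolP]|[-> /asboolP]].
Qed.

(** Well-founded recursion builds row [j] from the rows below it; unfolding [Fix] once gives the
    correctness condition. *)
Lemma correct_exists : exists Y, ~~ faulty Y.
Proof.
(* A call of [rec] needs a proof of [ltX], which the match on [@idP] supplies. Rows not below [j]
   read as false, as in [below]. *)
pose F j (rec : forall i, ltX X i j -> nat -> bool) m : bool :=
  fld X j && `[< theta m (fun a =>
    if @idP (ltX X (unpair a).2 j) is ReflectT lt then rec _ lt (unpair a).1 else false) >].
pose row := Fix ltX_wf (fun=> nat -> bool) F.
exists (fun p => row (unpair p).2 (unpair p).1); apply/not_faulty => p.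
rewrite /wrong negbK {1}/row Fix_eq -/row; last first.
  move=> j r r' rr'; have -> : r = r' by do 2![apply: functional_extensionality_dep => ?].
  by [].
rewrite {1}/F; apply/eqP; congr (_ && `[< theta _ _ >]); apply/funext => a.
by rewrite /below; case: {-}_ / idP => [->|/negP/negbTE ->].
Qed.

Lemma modulus_cover Y Y' : ~~ faulty Y' ->
  (forall i, i < modulus Y -> Y' i = Y i) -> ~~ faulty Y.
Proof.
move=> cY' agree; apply/negP => fY; move: agree; rewrite /modulus.
(* The successor in [modulus] puts [p] itself within the range of agreement. *)
case: ex_minnP => p; rewrite fY orbF => /andP[wp /asboolP np] _ /(_ p (leqnn _)) eqp.
have /not_faulty cY'' := cY'.
have := cY'' p; rewrite /wrong eqp (@below_eq Y' Y) => [|q qp].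
  by rewrite -/(wrong Y p) wp.
apply: (correct_below_unique _ _ qp) => r rp //.
by apply/negP => wr; apply: np; exists r; rewrite rp.
Qed.

End Recursion.

(** * Computability of the realiser *)

Section Deciding.
Variable k : nat.

(** The data that every decision below draws on, bundled because they pass together to extended
    contexts. *)
Record setting I N (c : I -> N.-tuple arg) (f : I -> nat -> nat)
    (X : I -> nat -> bool) : Prop := Setting {
  setting_Sfun : oracle c (fun=> Sfun k.+1 : ty 2);
  setting_matrix : computable1 c f;
  setting_order : computableb (ext 0 c) (fun p => X p.1 p.2) }.

Lemma setting_ext I N n (c : I -> N.-tuple arg) f X :
  setting c f X -> setting (ext n c) (fun p => f p.1) (fun p => X p.1).
Proof.
case=> cS cf cX; split; [exact: (oracle_ext n cS) | exact: comp_weak1 |].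
exact: (@comp_weak1 _ _ n c (fun i => chi (X i)) cX).
Qed.

Lemma dec_app I N (c : I -> N.-tuple arg) (Y : I -> nat -> bool) t :
  computableb (ext 0 c) (fun p => Y p.1 p.2) -> computable c t ->
  computableb c (fun i => Y i (t i)).
Proof. exact: (@comp1_app _ _ c (fun i => chi (Y i)) t). Qed.

Lemma dec_weak1 I N n (c : I -> N.-tuple arg) (Y : I -> nat -> bool) :
  computableb (ext 0 c) (fun p => Y p.1 p.2) ->
  computableb (ext 0 (ext n c)) (fun p => Y p.1.1 p.2).
Proof. exact: (@comp_weak1 _ _ n c (fun i => chi (Y i))). Qed.

Lemma dec_ltX I N (c : I -> N.-tuple arg) (X : I -> nat -> bool) t u :
  computableb (ext 0 c) (fun p => X p.1 p.2) -> computable c t -> computable c u ->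
  computableb c (fun i => ltX (X i) (t i) (u i)).
Proof.
move=> cX ct cu; apply: dec_and; last apply: dec_neg; apply: (dec_app cX);
  exact: comp_pair.
Qed.

Lemma dec_wrong I N (c : I -> N.-tuple arg) f X Y t :
  setting c f X -> computableb (ext 0 c) (fun p => Y p.1 p.2) -> computable c t ->
  computableb c (fun i => wrong (Pi1 k.+1 (f i)) (X i) (Y i) (t i)).
Proof.
case=> cS cf cX cY ct.
have ct2 := comp_unpair2 ct.
apply: dec_xor; first exact: dec_app cY ct.
apply: dec_and; first exact: (dec_app cX (comp_pair ct2 ct2)).
apply: dec_Pi1 cS cf (comp_unpair1 ct) _.
apply: dec_and; last exact: cY.
exact: (dec_ltX (X := fun p => X p.1) (dec_weak1 0 cX)
  (comp_unpair2 (comp_head c)) (comp_weak 0 ct2)).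
Qed.

Lemma dec_first_wrong I N (c : I -> N.-tuple arg) f X Y t :
  setting c f X -> computableb (ext 0 c) (fun p => Y p.1 p.2) -> computable c t ->
  computableb c (fun i => first_wrong (Pi1 k.+1 (f i)) (X i) (Y i) (t i)).
Proof.
move=> st cY ct; apply: dec_and; first exact: dec_wrong.
apply: dec_neg; apply: (dec_ex (setting_Sfun st)); apply: dec_and.
  apply: (dec_ltX (X := fun p => X p.1) (dec_weak1 0 (setting_order st))
    (comp_unpair2 (comp_head c))).
  exact: (comp_weak 0 (comp_unpair2 ct)).
exact: (dec_wrong (Y := fun p => Y p.1) (setting_ext 0 st)
  (dec_weak1 0 cY) (comp_head c)).
Qed.

Lemma dec_faulty I N (c : I -> N.-tuple arg) f X Y :
  setting c f X -> computableb (ext 0 c) (fun p => Y p.1 p.2) ->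
  computableb c (fun i => faulty (Pi1 k.+1 (f i)) (X i) (Y i)).
Proof.
move=> st cY; apply: (dec_ex (setting_Sfun st)).
exact: (dec_first_wrong (Y := fun p => Y p.1) (setting_ext 0 st)
  (dec_weak1 0 cY) (comp_head c)).
Qed.

Lemma comp_modulus I N (c : I -> N.-tuple arg) f X Y :
  setting c f X -> computableb (ext 0 c) (fun p => Y p.1 p.2) ->
  computable c (fun i => modulus (Pi1 k.+1 (f i)) (X i) (Y i)).
Proof.
move=> st cY; apply: comp_succ; apply: comp_mu; apply: dec_neg; apply: dec_or.
  exact: (dec_first_wrong (Y := fun p => Y p.1) (setting_ext 0 st)
  (dec_weak1 0 cY) (comp_head c)).
exact: (dec_neg (comp_weak 0 (dec_faulty st cY))).
Qed.

End Deciding.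

(** S8 demands a value of the functional at every function, not only at characteristic functions.
    Reading functions by their nonzero places extends [modulus] to all of them. *)
Definition support (g : nat -> nat) (n : nat) : bool := g n != 0.

Lemma chiK Y : support (chi Y) = Y.
Proof. by apply/funext => n; rewrite /support /chi; case: (Y n). Qed.

(* Past the end of Theta(G) the entry is the empty set; this is harmless, because
   an error-free empty set is the solution. *)
Definition entry (Theta : ((nat -> nat) -> nat) -> seq (nat -> bool)) theta X i :
    nat -> bool :=
  nth (fun=> false) (Theta (fun g => modulus theta X (support g))) i.

(** The request [<i, n> + 1] is the same at every [g], so it is found at the zero function, and the
    second components give back exactly [G]. *)
Lemma type3_ofE Theta (G : (nat -> nat) -> nat) i n :
  type3_of Theta (fun g => pair_code (pair_code i n).+1 (G g))
  = chi (nth (fun=> false) (Theta G) i) n.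
Proof.
have GE : (fun g => (unpair (pair_code (pair_code i n).+1 (G g))).2) = G.
  by apply/funext => g; rewrite pair_codeK.
rewrite /type3_of GE pair_codeK.
rewrite -[LHS]/(chi (nth _ (Theta G) (unpair (pair_code i n)).1)
                    (unpair (pair_code i n)).2).
by rewrite pair_codeK.
Qed.

Lemma dec_entry (k : nat) Theta I N (c : I -> N.-tuple arg) f X t u :
  setting k c f X -> oracle c (fun=> type3_of Theta : ty 3) ->
  computable c t -> computable c u ->
  computableb c (fun i => entry Theta (Pi1 k.+1 (f i)) (X i) (t i) (u i)).
Proof.
move=> st cT ct cu.
pose H (p : I * ty 1) := pair_code (pair_code (t p.1) (u p.1)).+1
   (modulus (Pi1 k.+1 (f p.1)) (X p.1) (support p.2)).
apply: (comp_ext _ (comp_S8 (n := 1) (F := H) cT _)) => [i|].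
  exact: type3_ofE.
apply: comp_pair; first exact: (comp_succ (comp_pair (comp_weak 1 ct) (comp_weak 1 cu))).
apply: comp_modulus (setting_ext 1 st) _.
apply: dec_neg; apply: dec_eq0.
exact: (comp1_oracle (oracle_head 1 c)).
Qed.

Theorem corollary4p24 (k : nat) (hk : 1 <= k)
    (Theta : ((nat -> nat) -> nat) -> seq (nat -> bool)) (hTheta : SFF Theta) :
  exists Psi : TR_functional,
    TR_realiser k Psi /\
    computes [:: Arg (n := 2) (Sfun k); Arg (n := 3) (type3_of Theta)] Psi.
Proof.
case: k hk => // k _.
exists (fun X _ f n => `[< exists i,
  ~~ faulty (Pi1 k.+1 f) X (entry Theta (Pi1 k.+1 f) X i) && entry Theta (Pi1 k.+1 f) X i n >]); split.
  move=> X lt f _ woX; set theta := Pi1 k.+1 f.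
  have [Y0 cY0] := correct_exists theta woX.
  (* The binary sequence to be covered is the solution [Y0] itself. *)
  have [g [gin gY0]] := hTheta (fun g => modulus theta X (support g)) Y0.
  rewrite chiK in gY0.
  have gE : g = Y0 := correct_unique woX (modulus_cover woX cY0 gY0) cY0.
  have [i [_ hi]] := List.In_nth _ _ (fun=> false) gin.
  have enti : entry Theta theta X i = Y0.
    (* The induction identifies [List.nth] with the [nth] of sequences. *)
    by rewrite -gE -hi /entry; elim: (Theta _) (i) => [|a s IH] [|l] /=.
  suff -> : (fun n => `[< exists i, ~~ faulty theta X (entry Theta theta X i)
                           && entry Theta theta X i n >]) = Y0 by apply: correct_Hth.
  (* By uniqueness every error-free entry equals [Y0], so it does not matter which index witnesses
     membership. *)
  apply/funext => n; apply/asboolP/idP => [[l /andP[cl hl]]|Yn].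
    by rewrite -(correct_unique woX cl cY0).
  by exists i; rewrite enti cY0.
pose I := ((nat -> bool) * (nat -> nat -> bool) * (nat -> nat) * nat)%type.
pose c (x : I) := [tuple num x.2; fct (chi x.1.1.1); fct (chi2 x.1.1.2); fct x.1.2;
   Arg (n := 2) (Sfun k.+1); Arg (n := 3) (type3_of Theta)].
suff [e he] : computableb c (fun x => `[< exists i,
    ~~ faulty (Pi1 k.+1 x.1.2) x.1.1.1 (entry Theta (Pi1 k.+1 x.1.2) x.1.1.1 i)
    && entry Theta (Pi1 k.+1 x.1.2) x.1.1.1 i x.2 >]).
  by exists e => X lt f n; apply: (he (X, lt, f, n)).
have st : setting k c (fun x => x.1.2) (fun x => x.1.1.1).
  split; first by exists 4.
    by apply: comp1_oracle; exists 3.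
  by apply: (@comp1_oracle _ _ c (fun x => chi x.1.1.1)); exists 1.
have cT : oracle c (fun=> type3_of Theta : ty 3) by exists 5.
have cn : computable c (fun x => x.2) by apply: comp_num; exists 0.
(* The index of the entry is an unbounded number quantifier, which [Sfun] decides. *)
apply: (dec_ex (setting_Sfun st)); apply: dec_and; last first.
  exact: (dec_entry (setting_ext 0 st) (oracle_ext 0 cT) (comp_head c) (comp_weak 0 cn)).
apply: dec_neg; apply: (dec_faulty (setting_ext 0 st)).
apply: (dec_entry (setting_ext 0 (setting_ext 0 st)) (oracle_ext 0 (oracle_ext 0 cT))).
  exact: (comp_weak 0 (comp_head c)).
exact: comp_head.
Qed.
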